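(* Consider the following linear network processes (identity activation and output functions), in which the gates are replaced by constant diagonal matrices $D_i,D_f,D_o$, with input $x^{(t)}$ and i.i.d. errors $\varepsilon^{(t)}$: (constant-gates-LSTM) $y^{(t)}=W_{zh}h^{(t)}+\varepsilon^{(t)}$, $\tilde c^{(t)}=W_{ch}h^{(t-1)}+W_{cx}x^{(t)}$, $c^{(t)}=D_i\tilde c^{(t)}+D_fc^{(t-1)}$, $h^{(t)}=D_oc^{(t)}$; (constant-gates-MLSTM) $y^{(t)}=W_{zh}h^{(t)}+\varepsilon^{(t)}$, $\tilde c^{(t)}=W_{ch}h^{(t-1)}+W_{cx}x^{(t)}$, $(I-\mathcal{B})^dc^{(t)}=D_i\tilde c^{(t)}$, $h^{(t)}=D_oc^{(t)}$, with memory parameter $d=(d_1,\dots,d_q)'$, $d_i\in(0,0.5)$. Then, in terms of the definition of long memory network process below, the constant-gates-MLSTM has the capability of handling long-range dependence data (its process can have long memory), while the constant-gates-LSTM cannot.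
   Context: $B$ is the backshift operator, $B^jX_t=X_{t-j}$. For scalar $d$, $(1-B)^d=\sum_{j=0}^\infty w_j(d)B^j$ with $w_j(d)=\prod_{i=0}^{j-1}(i-d)/(i+1)$, asymptotically proportional to $j^{-d-1}$. For a vector $d$, $(I-\mathcal{B})^d=\mathrm{diag}((1-B)^{d_1},\dots,(1-B)^{d_q})$ acting componentwise. A network process of the form $y^{(t)}=\sum_{k=0}^\infty A_kx^{(t-k)}+\varepsilon^{(t)}$ with coefficient matrices $A_k$ and i.i.d. $\varepsilon^{(t)}$ has long memory if there exist indices $i,j$ and $d\in(0,0.5)$ such that $(A_k)_{ij}\sim k^{-d-1}$ as $k\to\infty$ (decay at this polynomial rate). A network has the capability of handling long-range dependence data if its (linearized) network process has long memory in this sense. *)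

(* Defs.v *)
From HB Require Import structures.
From mathcomp Require Import all_boot all_order all_algebra.
From mathcomp Require Import all_classical all_reals all_analysis.
Set Implicit Arguments. Unset Strict Implicit. Unset Printing Implicit Defensive.
Import Order.TTheory GRing.Theory Num.Theory.
Import numFieldNormedType.Exports.
Local Open Scope classical_set_scope.
Local Open Scope ring_scope.

Section Defs.
Variable R : realType.

(* Coefficient w_j(d) of (1 - B)^d = sum_j w_j(d) B^j. *)
Definition frac_w (d : R) (j : nat) : R :=
  \prod_(i < j) ((i%:R - d) / (i%:R + 1)).

Definition asym_prop_pow (u : nat -> R) (e : R) : Prop :=
  exists c : R, c != 0 /\
    (fun k : nat => u k / (k%:R `^ (- e - 1))) @ \oo --> c.

(* A network process y_t = sum_k A_k x_{t-k} + eps_t has long memory. *)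
Definition long_memory (r p : nat) (A : nat -> 'M[R]_(r, p)) : Prop :=
  exists (i : 'I_r) (j : 'I_p) (e : R), 0 < e < 1/2 /\
    asym_prop_pow (fun k => A k i j) e.

(* Constant-gates LSTM (linear): c_t = (D_i W_ch D_o + D_f) c_{t-1} + D_i W_cx x_t,
   so c_t = sum_k C_k x_{t-k} with C_0 = D_i W_cx, C_k = M C_{k-1},
   and y_t = W_zh D_o c_t + eps_t, i.e. A_k = W_zh D_o C_k. *)
Fixpoint lstm_C (p q : nat) (Wch : 'M[R]_q) (Wcx : 'M[R]_(q, p))
    (di df dout : 'rV[R]_q) (k : nat) : 'M[R]_(q, p) :=
  match k with
  | 0 => diag_mx di *m Wcx
  | k'.+1 => (diag_mx di *m Wch *m diag_mx dout + diag_mx df)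
               *m lstm_C Wch Wcx di df dout k'
  end.

Definition lstm_coeffs (p q r : nat) (Wzh : 'M[R]_(r, q)) (Wch : 'M[R]_q)
    (Wcx : 'M[R]_(q, p)) (di df dout : 'rV[R]_q) (k : nat) : 'M[R]_(r, p) :=
  Wzh *m diag_mx dout *m lstm_C Wch Wcx di df dout k.

(* Constant-gates MLSTM (linear):
   (I - B)^d c_t = D_i (W_ch D_o c_{t-1} + W_cx x_t).
   Writing c_t = sum_k C_k x_{t-k} and matching coefficients (w_0 = 1):
   C_0 = D_i W_cx,
   C_k = D_i W_ch D_o C_{k-1} - sum_{j=1}^{k} diag(w_j(d)) C_{k-j}.
   mlstm_hist k = [:: C_0; ...; C_k]. *)
Fixpoint mlstm_hist (p q : nat) (d : 'rV[R]_q) (Wch : 'M[R]_q)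
    (Wcx : 'M[R]_(q, p)) (di dout : 'rV[R]_q) (k : nat) : seq 'M[R]_(q, p) :=
  match k with
  | 0 => [:: diag_mx di *m Wcx]
  | k'.+1 =>
      let s := mlstm_hist d Wch Wcx di dout k' in
      rcons s (diag_mx di *m Wch *m diag_mx dout *m nth 0 s k'
               - \sum_(j < k'.+1)
                   diag_mx (\row_l frac_w (d 0 l) j.+1) *m nth 0 s (k' - j))
  end.

Definition mlstm_C (p q : nat) (d : 'rV[R]_q) (Wch : 'M[R]_q)
    (Wcx : 'M[R]_(q, p)) (di dout : 'rV[R]_q) (k : nat) : 'M[R]_(q, p) :=
  nth 0 (mlstm_hist d Wch Wcx di dout k) k.

Definition mlstm_coeffs (p q r : nat) (d : 'rV[R]_q) (Wzh : 'M[R]_(r, q))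
    (Wch : 'M[R]_q) (Wcx : 'M[R]_(q, p)) (di dout : 'rV[R]_q) (k : nat)
    : 'M[R]_(r, p) :=
  Wzh *m diag_mx dout *m mlstm_C d Wch Wcx di dout k.

End Defs.

(* Main.v *)
(** LSTM: A_k is an entry of U M^k V, so by Cayley-Hamilton it is annihilated by
    a nonzero polynomial in the shift. If A_k ~ c k^(-e-1) with c <> 0, then
    consecutive ratios tend to 1 and every annihilator vanishes at 1; dividing
    by X - 1 leaves a sequence that is constant and tends to 0, hence a smaller
    annihilator, and descent on the degree gives a contradiction.

    MLSTM: with D_i = D_o = I and W_ch = -(d/2) I each coordinate satisfies
    C(z) = 1 / (1 - b(z)) where 1 - b(z) = (1 - z)^d + (d/2) z. The
    coefficients of b are positive, have total mass less than 1 and decay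
    like k^(-d-1), so b is subexponential and the defective renewal sequence
    C_k inherits the decay of b. (With W_ch = 0 the coefficients would decay
    like k^(d-1), and with a positive multiple of I they would grow
    exponentially.) *)
Require Import Defs.
From HB Require Import structures.
From mathcomp Require Import all_boot all_order all_algebra.
From mathcomp Require Import all_classical all_reals all_analysis.
From mathcomp Require Import ring lra zify.
Set Implicit Arguments. Unset Strict Implicit. Unset Printing Implicit Defensive.
Import Order.TTheory GRing.Theory Num.Theory.
Import numFieldNormedType.Exports.
Local Open Scope classical_set_scope.
Local Open Scope ring_scope.

(** * Renewal sequences *)

Lemma cvgn_eq_from (R : realType) (u v : nat -> R) (l : R) (K : nat) :
  (forall k, (K <= k)%N -> u k = v k) -> u @ \oo --> l -> v @ \oo --> l.
Proof.
by move=> uv; apply: cvg_trans; apply: near_eq_cvg; exists K => // k /= /uv.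
Qed.

Lemma cvgn_bounded_le (R : realType) (u : nat -> R) (M l : R) (K : nat) :
  (forall k, (K <= k)%N -> u k <= M) -> u @ \oo --> l -> l <= M.
Proof.
move=> uM ul; rewrite -(cvg_lim _ ul) //.
apply: limr_le; first by apply: cvgP ul.
by exists K => // k /= Kk; exact: uM.
Qed.

Lemma nonneg_series_le (R : realType) (f : nat -> R) (F : R) (n : nat) :
  (forall k, 0 <= f k) -> series f @ \oo --> F -> \sum_(0 <= j < n) f j <= F.
Proof.
move=> f0 fF; rewrite -(cvg_lim _ fF) //.
have /nondecreasing_cvgn_le : {homo series f : m p / (m <= p)%N >-> m <= p}.
  by apply/nondecreasing_seqP => k; rewrite seriesEnat /= big_nat_recr //= lerDl.
by move=> /(_ (cvgP _ fF) n); rewrite seriesEnat.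
Qed.

Lemma nonneg_series_is_cvg (R : realType) (f : nat -> R) (M : R) :
  (forall k, 0 <= f k) -> (forall n, \sum_(0 <= j < n) f j <= M) ->
  cvgn (series f).
Proof.
move=> f0 fM; apply: (@nondecreasing_is_cvgn R (series f)).
  by apply/nondecreasing_seqP => k; rewrite seriesEnat /= big_nat_recr //= lerDl.
by exists M => _ [n _ <-]; rewrite seriesEnat; exact: fM.
Qed.

Lemma cvg_sum_nat (R : realType) (g : nat -> nat -> R) (l : nat -> R) (J : nat) :
  (forall j, g ^~ j @ \oo --> l j) ->
  (fun k => \sum_(0 <= j < J) g k j) @ \oo --> \sum_(0 <= j < J) l j.
Proof.
move=> gl; elim: J => [|J IH].
  rewrite big_nil; under eq_fun do rewrite big_nil; exact: cvg_cst.
rewrite big_nat_recr //=; under eq_fun do rewrite big_nat_recr //=.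
exact: cvgD.
Qed.

(* Tannery's theorem: the tail of the series f absorbs the terms with large j. *)
Lemma tannery0 (R : realType) (f : nat -> R) (F K : R) (h : nat -> nat -> R)
    (N : nat -> nat) :
  (forall j, 0 <= f j) -> series f @ \oo --> F ->
  (forall j, h ^~ j @ \oo --> 0) ->
  (forall k j, `|h k j| <= K) ->
  (fun k => \sum_(0 <= j < N k) f j * h k j) @ \oo --> 0.
Proof.
move=> f0 fF h0 hK.
have K0 : 0 <= K by apply: le_trans (hK 0%N 0%N).
apply/cvgr0Pnorm_le => e e0.
(* The divisor is [K + 1] because [K] may be 0. *)
have K1 : 0 < K + 1 by apply: ltr_wpDl.
have eK : 0 < e / 2 / (K + 1) by rewrite !divr_gt0.
have [J _ HJ] : \forall J \near \oo, `|F - series f J| <= e / 2 / (K + 1).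
  by move/cvgrPdist_le : fF; apply.
have {}HJ : F - \sum_(0 <= j < J) f j <= e / 2 / (K + 1).
  by apply: le_trans (HJ J _) => //=; rewrite seriesEnat; exact: ler_norm.
have : (fun k => \sum_(0 <= j < J) f j * `|h k j|) @ \oo --> 0.
  have := @cvg_sum_nat R (fun k j => f j * `|h k j|) (fun=> 0) J.
  rewrite big1 //; apply => j; rewrite -(mulr0 (f j)).
  apply: cvgM; first exact: cvg_cst.
  by apply/norm_cvg0P; exact: h0.
move/cvgr0Pnorm_le => /(_ _ (divr_gt0 e0 (ltr0n _ 2))) [k0 _ Hk0].
exists k0 => // k /= k0k.
have := Hk0 k k0k => /=.
set s := \sum_(0 <= j < J) _ => hs.
apply: (le_trans (ler_norm_sum _ _ _)).
have -> : \sum_(0 <= j < N k) `|f j * h k j| = \sum_(0 <= j < N k) f j * `|h k j|.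
  by apply: eq_bigr => j _; rewrite normrM ger0_norm.
have nn j : 0 <= f j * `|h k j| by rewrite mulr_ge0.
have [NJ|JN] := leqP (N k) J.
  apply: (@le_trans _ _ s); last first.
    by apply: le_trans (ler_norm _) _; apply: le_trans hs _; lra.
  by rewrite /s (big_cat_nat (leq0n _) NJ) //= lerDl sumr_ge0.
rewrite (big_cat_nat (leq0n _) (ltnW JN)) //= -/s.
have : \sum_(J <= j < N k) f j * `|h k j| <= e / 2.
  apply: (@le_trans _ _ (\sum_(J <= j < N k) f j * (K + 1))).
    apply: ler_sum => j _; apply: ler_wpM2l => //.
    by apply: le_trans (hK _ _) _; rewrite lerDl.
  rewrite -mulr_suml -ler_pdivlMr //.
  have := @nonneg_series_le _ f F (N k) f0 fF.
  rewrite (big_cat_nat (leq0n _) (ltnW JN)) //=; lra.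
have := ler_norm s; lra.
Qed.

(** Replacing [h k j] by [h k j - l] for [j < N k] and by 0 elsewhere reduces to [tannery0]; what
    remains is [l] times a partial sum of [f]. *)
Lemma tannery (R : realType) (f : nat -> R) (F K l : R) (h : nat -> nat -> R)
    (N : nat -> nat) :
  (forall j, 0 <= f j) -> series f @ \oo --> F ->
  (forall j, h ^~ j @ \oo --> l) ->
  (forall k j, (j < N k)%N -> `|h k j| <= K) ->
  N @ \oo --> \oo ->
  (fun k => \sum_(0 <= j < N k) f j * h k j) @ \oo --> F * l.
Proof.
move=> f0 fF hl hK Noo.
pose h' k j := if (j < N k)%N then h k j - l else 0.
have h'0 j : h' ^~ j @ \oo --> 0.
  have : (fun k => h k j - l) @ \oo --> 0.
    by rewrite -(subrr l); apply: cvgB; [exact: hl|exact: cvg_cst].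
  apply: cvg_trans; apply: near_eq_cvg.
  have : \forall n \near \oo, (j < n)%N by exists j.+1.
  by move/Noo => [k0 _ H]; exists k0 => // k /= /H; rewrite /= /h' => ->.
have h'K k j : `|h' k j| <= `|K| + `|l|.
  rewrite /h'; case: ifP => [/hK jN|_]; last by rewrite normr0 addr_ge0.
  apply: le_trans (ler_normB _ _) _; rewrite lerD2r.
  exact: le_trans jN (ler_norm _).
have T := @tannery0 _ f F _ h' N f0 fF h'0 h'K.
have S : (fun k => (\sum_(0 <= j < N k) f j) * l) @ \oo --> F * l.
  apply: cvgM; last exact: cvg_cst.
  have : (series f \o N) @ \oo --> F.
    exact: (@cvg_comp _ _ _ N (series f) _ _ _ Noo fF).
  by rewrite seriesEnat.
rewrite -[F * l]add0r.
apply: (@cvgn_eq_from R _ _ _ 0) (cvgD T S) => k _.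
rewrite !fctE mulr_suml -big_split /=.
by apply: eq_big_nat => j /andP[_ jN]; rewrite /h' jN; ring.
Qed.

(* A bound m + e/2 valid from N on improves to theta m + e/2 from 2N on. *)
Lemma contraction_cvg0 (R : realType) (y z : nat -> R) (Y theta : R) :
  0 <= theta < 1 -> (forall k, 0 <= y k <= Y) -> z @ \oo --> 0 ->
  (\forall k \near \oo, forall m : R,
     (forall i, (k./2 <= i)%N -> y i <= m) -> y k <= theta * m + z k) ->
  y @ \oo --> 0.
Proof.
move=> /andP[t0 t1] yY z0 [k0 _ rec].
apply/cvgr0Pnorm_le => e e0.
have u0 : 0 < 1 - theta by rewrite subr_gt0.
(* Chosen so that [theta * (e / 2) + e' = e / 2]: the offset survives every round while the other
   part of the bound shrinks by [theta]. *)
pose e' := e / 2 * (1 - theta).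
have e'0 : 0 < e' by rewrite /e' !mulr_gt0 // invr_gt0.
have [k1 _ zk1] : \forall k \near \oo, `|z k| <= e' by move/cvgr0Pnorm_le : z0; apply.
have step n : exists N, forall k, (N <= k)%N -> y k <= theta ^+ n * Y + e / 2.
  elim: n => [|n [N IH]].
    exists 0%N => k _; rewrite expr0 mul1r.
    by have /andP[_ ?] := yY k; lra.
  exists (maxn (maxn k0 k1) N.*2) => k.
  rewrite !geq_max => /andP[/andP[kk0 kk1] kN].
  have /rec : forall i, (k./2 <= i)%N -> y i <= theta ^+ n * Y + e / 2.
    by move=> i ki; apply: IH; lia.
  move=> /(_ kk0) /le_trans; apply.
  have := zk1 k kk1; rewrite /= => /(le_trans (ler_norm _)).
  rewrite /e' exprS -mulrA; lra.
have Y0 : 0 <= Y by have /andP[/le_trans] := yY 0%N; apply.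
have : (fun n => theta ^+ n * Y) @ \oo --> 0.
  rewrite -(mul0r Y); apply: cvgM; last exact: cvg_cst.
  by apply: cvg_expr; rewrite ger0_norm.
move/cvgr0Pnorm_le => /(_ _ (divr_gt0 e0 (ltr0n _ 2))) [n _ Hn].
have := Hn n (leqnn n); rewrite /= => /(le_trans (ler_norm _)) {}Hn.
have [N HN] := step n; exists N => // k /= /HN.
by have /andP[? _] := yY k; rewrite ger0_norm //; lra.
Qed.

(** For fixed [j] this is eventually a product of [j] inverse consecutive ratios, each tending to 1.
    Shifting by [j] discards the indices where the subtraction truncates. *)
Lemma cvg_ratio_shift (R : realType) (b : nat -> R) (j : nat) :
  (forall k, 0 < b k) -> (fun k => b k.+1 / b k) @ \oo --> (1 : R) ->
  (fun k => b (k - j)%N / b k) @ \oo --> (1 : R).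
Proof.
move=> b0 b1.
have : (fun n => b n / b (n + j)%N) @ \oo --> (1 : R).
  elim: j => [|j IH].
    apply: (@cvgn_eq_from R (fun=> 1) _ _ 0) (cvg_cst (1 : R)) => k _.
    by rewrite addn0 divff // gt_eqF.
  have b1j : (fun n => (b (n + j).+1 / b (n + j)%N)^-1) @ \oo --> (1 : R).
    rewrite -(invr1 R); apply: cvgV; first exact: oner_neq0.
    by have := b1; rewrite -(cvg_shiftn j).
  rewrite -(mulr1 1).
  apply: (@cvgn_eq_from R _ _ _ 0) (cvgM IH b1j) => k _ /=; rewrite addnS.
  by rewrite invf_div mulrA divfK // gt_eqF.
move=> H; rewrite -(cvg_shiftn j).
by apply: (@cvgn_eq_from R _ _ _ 0) H => k _ /=; rewrite addnK.
Qed.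

(** This is the identity [C(z) = 1 + z B(z) C(z)] divided by [1 - z], read off coefficientwise. It
    makes the recursion usable for bounds and limits of partial sums. *)
Lemma renewal_partial_sums (R : realType) (b c : nat -> R) (n : nat) :
  c 0%N = 1 ->
  (forall k, c k.+1 = \sum_(0 <= j < k.+1) b j * c (k - j)%N) ->
  \sum_(0 <= k < n.+1) c k =
  1 + \sum_(0 <= j < n) b j * \sum_(0 <= i < n - j) c i.
Proof.
move=> c0 rec; elim: n => [|n IH]; first by rewrite big_nat1 big_nil addr0.
rewrite big_nat_recr //= IH [c n.+1]rec -addrA; congr (_ + _).
transitivity (\sum_(0 <= j < n.+1) b j * \sum_(0 <= i < n - j) c i
   + \sum_(0 <= j < n.+1) b j * c (n - j)%N).
  by rewrite [in RHS]big_nat_recr //= subnn big_nil mulr0 addr0.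
rewrite -big_split /=; apply: eq_big_nat => j /andP[_ jn].
by rewrite -mulrDr subSn // big_nat_recr.
Qed.

(** Since [(1 - rho)^-1] solves [x = 1 + rho * x], it bounds the partial sums by induction.
    Tannery's theorem then shows that the sum solves the same equation. *)
Lemma renewal_sum (R : realType) (b c : nat -> R) (rho : R) :
  (forall k, 0 <= b k) -> series b @ \oo --> rho -> rho < 1 ->
  c 0%N = 1 ->
  (forall k, c k.+1 = \sum_(0 <= j < k.+1) b j * c (k - j)%N) ->
  (forall k, 0 <= c k) /\ series c @ \oo --> (1 - rho)^-1.
Proof.
move=> b0 brho rho1 c0 rec.
have cge0 k : 0 <= c k.
  have [n] := ubnP k; elim: n k => // n IH [|k] kn; first by rewrite c0 ler01.
  rewrite rec big_nat; apply: sumr_ge0 => j /andP[_ jk].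
  by rewrite mulr_ge0 // IH //; lia.
split=> //.
have r0 : 0 < 1 - rho by rewrite subr_gt0.
have bound n : \sum_(0 <= k < n) c k <= (1 - rho)^-1.
  have [m] := ubnP n; elim: m n => // m IH [|n] nm.
    by rewrite big_nil invr_ge0 ltW.
  rewrite (@renewal_partial_sums _ b) //.
  have : \sum_(0 <= j < n) b j * \sum_(0 <= i < n - j) c i <=
         \sum_(0 <= j < n) b j * (1 - rho)^-1.
    apply: ler_sum_nat => j /andP[_ jn].
    by rewrite ler_wpM2l // IH //; lia.
  rewrite -mulr_suml => H.
  have {H} := le_trans H (ler_wpM2r _ (nonneg_series_le n b0 brho)).
  rewrite invr_ge0 ltW // => /(_ isT) H.
  have -> : (1 - rho)^-1 = 1 + rho * (1 - rho)^-1 by field; rewrite gt_eqF.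
  by rewrite lerD2l.
have cc := nonneg_series_is_cvg cge0 bound.
set S := limn (series c) in cc.
have sumS : (fun n => \sum_(0 <= k < n) c k) @ \oo --> S.
  by have := cc; rewrite seriesEnat.
have T : (fun n => \sum_(0 <= j < n) b j * \sum_(0 <= i < n - j) c i)
    @ \oo --> rho * S.
  apply: (@tannery R b rho (1 - rho)^-1 S
    (fun n j => \sum_(0 <= i < n - j) c i) id) => //.
    move=> j; rewrite -(cvg_shiftn j) /=.
    by under eq_fun do rewrite addnK.
  by move=> n j _; rewrite ger0_norm ?bound // sumr_ge0.
have e : S = 1 + rho * S.
  apply: (@cvg_unique _ _ ((fun n => \sum_(0 <= k < n.+1) c k) @ \oo)) => //.
    by have := sumS; rewrite -cvg_shiftS.
  apply: (@cvgn_eq_from R _ _ _ 0) (cvgD (cvg_cst (1 : R)) T) => n _.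
  by rewrite (@renewal_partial_sums _ b).
suff <- : S = (1 - rho)^-1 by [].
by apply: (mulIf (lt0r_neq0 r0)); rewrite mulVf ?lt0r_neq0 //; lra.
Qed.

(* With x_k = c_(k+1) / b_k, the recursion splits at j = k/2 into a contraction
   of x of mass rho and a source term tending to 1/(1 - rho). *)
Theorem renewal_ratio (R : realType) (b c : nat -> R) (K rho : R) :
  (forall k, 0 < b k) ->
  (forall j k, (j <= k <= j.*2.+1)%N -> b j <= K * b k) ->
  (fun k => b k.+1 / b k) @ \oo --> (1 : R) ->
  series b @ \oo --> rho -> rho < 1 ->
  c 0%N = 1 ->
  (forall k, c k.+1 = \sum_(0 <= j < k.+1) b j * c (k - j)%N) ->
  (fun k => c k.+1 / b k) @ \oo --> ((1 - rho)^-1 ^+ 2 : R).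
Proof.
move=> b0 bK b1 brho rho1 c0 rec.
have bge0 k : 0 <= b k by exact: ltW.
have bn0 k : b k != 0 by rewrite gt_eqF.
have [cge0 cS] := renewal_sum bge0 brho rho1 c0 rec.
have u0 : 0 < 1 - rho by rewrite subr_gt0.
have rho0 : 0 <= rho.
  by apply: le_trans (nonneg_series_le 0 bge0 brho); rewrite big_nil.
set S := (1 - rho)^-1 in cS *.
have S0 : 0 < S by rewrite invr_gt0.
pose x k := c k.+1 / b k.
have x0 k : 0 <= x k by rewrite divr_ge0.
pose q k j := b (k - j)%N / b k.
have q0 k j : 0 <= q k j by rewrite divr_ge0.
(* The case [j.*2 = k.+1] occurs in [r] for odd [k]; the [.+1] in the doubling hypothesis admits
   it. *)
have qK k j : (j.*2 <= k.+1)%N -> q k j <= K.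
  by move=> jk; rewrite ler_pdivrMr // bK //; lia.
pose r k := \sum_(0 <= j < uphalf k) b j * q k j.+1.
pose t k := \sum_(0 <= i < k./2.+1) c i * q k i.
have r0 k : 0 <= r k by apply: sumr_ge0 => j _; rewrite mulr_ge0.
have rcvg : r @ \oo --> rho.
  rewrite -(mulr1 rho).
  apply: (@tannery R b rho K 1 (fun k j => q k j.+1) uphalf) => //.
  - by move=> j; exact: cvg_ratio_shift.
  - by move=> k j jk; rewrite ger0_norm // qK //; lia.
  - by move=> A [n _ nA]; exists n.*2 => // k /= nk; apply: nA => /=; lia.
have tcvg : t @ \oo --> S.
  rewrite -(mulr1 S).
  apply: (@tannery R c S K 1 q (fun k => k./2.+1)) => //.
  - by move=> j; exact: cvg_ratio_shift.
  - by move=> k j jk; rewrite ger0_norm // qK //; lia.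
  - by move=> A [n _ nA]; exists n.*2 => // k /= nk; apply: nA => /=; lia.
(* The upper half of the sum is reversed, so that [c] has index at most [k./2] and plays the role of
   the summable weight in [t]. *)
have xrec k : x k = \sum_(0 <= j < uphalf k) b j * q k j.+1 * x (k - j.+1)%N + t k.
  rewrite /x rec (big_cat_nat (n := uphalf k)) //=; last by lia.
  rewrite mulrDl; congr (_ + _).
    rewrite mulr_suml; apply: eq_big_nat => j /andP[_ jk].
    have -> : (k - j = (k - j.+1).+1)%N by lia.
    by rewrite /q; field; rewrite !bn0.
  rewrite /t mulr_suml big_nat_rev /= -{1}(add0n (uphalf k)) big_addn.
  have -> : (k.+1 - uphalf k = k./2.+1)%N by lia.
  apply: eq_big_nat => i /andP[_ ik].
  have -> : (uphalf k + k.+1 - (i + uphalf k).+1 = k - i)%N by lia.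
  have -> : (k - (k - i) = i)%N by lia.
  by rewrite /q; field; rewrite bn0.
(* The midpoint of [rho] and 1: above the limit of [r], yet still a contraction factor. *)
pose theta := (1 + rho) / 2.
have th : 0 <= theta < 1 by rewrite /theta; lra.
have /andP[th0 th1] := th.
have [N _ rN] : \forall k \near \oo, r k <= theta.
  by apply: (cvgr_le _ rcvg); rewrite /theta; lra.
have tB k : t k <= K * S.
  apply: le_trans (ler_wpM2l _ (nonneg_series_le k./2.+1 cge0 cS)); last first.
    exact: le_trans (q0 0%N 0%N) (qK 0%N 0%N _).
  rewrite mulr_sumr; apply: ler_sum_nat => j jk.
  by rewrite mulrC ler_wpM2r // qK //; lia.
have K0 : 0 <= K by exact: le_trans (q0 0%N 0%N) (qK 0%N 0%N _).
(* The first summand dominates every [x k] with [k < N]; the second ensures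
   [theta * X + K * S <= X], so the bound propagates through the recursion. *)
pose X := \sum_(0 <= k < N) x k + K * S / (1 - theta).
have KSth : 0 <= K * S / (1 - theta).
  by rewrite divr_ge0 ?mulr_ge0 ?(ltW S0) // subr_ge0 ltW.
have xX k : x k <= X.
  have [n] := ubnP k; elim: n k => // n IH k kn.
  have [kN|Nk] := ltnP k N.
    rewrite /X big_mkord (bigD1 (Ordinal kN)) //= -addrA lerDl.
    by rewrite addr_ge0 // sumr_ge0.
  rewrite xrec.
  have : \sum_(0 <= j < uphalf k) b j * q k j.+1 * x (k - j.+1)%N <= r k * X.
    rewrite mulr_suml; apply: ler_sum_nat => j /andP[_ jk].
    by apply: ler_wpM2l; [rewrite mulr_ge0|apply: IH; lia].
  have X0 : K * S / (1 - theta) <= X by rewrite lerDr sumr_ge0.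
  have := ler_wpM2r (le_trans KSth X0) (rN k Nk).
  have := tB k.
  have : K * S <= X * (1 - theta) by rewrite -ler_pdivrMr // subr_gt0.
  rewrite /=; lra.
set L := S ^+ 2.
(* [L] is the fixed point of the limiting recursion; subtracting this equation from [xrec] leaves a
   contraction for [x k - L] with error at most [z k]. *)
have LS : L = rho * L + S by rewrite /L /S; field; rewrite gt_eqF.
pose z k := `|L * (r k - rho)| + `|t k - S|.
have zcvg : z @ \oo --> (0 : R).
  rewrite -(addr0 0); apply: cvgD; apply/norm_cvg0P.
    rewrite -(mulr0 L) -(subrr rho); apply: cvgM; first exact: cvg_cst.
    by apply: cvgB => //; exact: cvg_cst.
  by rewrite -(subrr S); apply: cvgB => //; exact: cvg_cst.
have : (fun k => `|x k - L|) @ \oo --> (0 : R).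
  apply: (@contraction_cvg0 R _ z (X + L) theta) => //.
    move=> k; rewrite normr_ge0 /= ler_norml.
    have := x0 k; have := xX k; have : 0 <= L by rewrite exprn_ge0 // ltW.
    have : 0 <= X by apply: le_trans (xX 0%N).
    by move=> *; apply/andP; split; lra.
  exists N => // k /= Nk m ym.
  have m0 : 0 <= m by apply: le_trans (ym k _) => //; lia.
  have -> : x k - L =
    \sum_(0 <= j < uphalf k) b j * q k j.+1 * (x (k - j.+1)%N - L)
    + (L * (r k - rho) + (t k - S)).
    under eq_bigr do rewrite mulrBr.
    rewrite sumrB -mulr_suml -/(r k) xrec; move: LS; lra.
  apply: (le_trans (ler_normD _ _)); apply: lerD; last exact: ler_normD.
  apply: (@le_trans _ _ (r k * m)); last by rewrite ler_wpM2r // rN.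
  apply: (le_trans (ler_norm_sum _ _ _)).
  rewrite mulr_suml; apply: ler_sum_nat => j /andP[_ jk].
  have bq : 0 <= b j * q k j.+1 by rewrite mulr_ge0.
  (* From [j < uphalf k] follows [k./2 <= k - j.+1], the range in which [m] is a bound. *)
  by rewrite normrM (ger0_norm bq) ler_wpM2l // ym //; lia.
move/norm_cvg0P => xL0.
rewrite -[L]add0r.
by apply: (@cvgn_eq_from R _ _ _ 0) (cvgD xL0 (cvg_cst L)) => k _ /=; rewrite !fctE subrK.
Qed.

(** * Fractional differencing weights *)

(** Young's inequality for the product of [a^d] and 1, with conjugate exponents [1/d] and
    [1/(1-d)]. *)
Lemma powR_Bernoulli (R : realType) (a d : R) :
  0 <= a -> 0 < d < 1 -> a `^ d <= 1 + d * (a - 1).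
Proof.
move=> a0 /andP[d0 d1].
have := @conjugate_powR R (a `^ d) 1 d^-1 (1 - d)^-1 (powR_ge0 _ _) ler01.
rewrite !invr_gt0 subr_gt0 !invrK => /(_ d0 d1).
rewrite -powRrM mulfV ?gt_eqF // powRr1 // powR1 mulr1 mul1r.
by rewrite addrC subrK => /(_ erefl); lra.
Qed.

Lemma frac_w1 (R : realType) (d : R) : frac_w d 1 = - d.
Proof. by rewrite /frac_w big_ord1 !add0r invr1 mulr1. Qed.

Lemma frac_wS (R : realType) (d : R) (k : nat) :
  frac_w d k.+1 = frac_w d k * ((k%:R - d) / (k%:R + 1)).
Proof. by rewrite /frac_w big_ord_recr. Qed.

Lemma frac_w_neg (R : realType) (d : R) (k : nat) :
  0 < d < 1 -> 0 < - frac_w d k.+1.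
Proof.
move=> /andP[d0 d1]; elim: k => [|k IH]; first by rewrite frac_w1 opprK.
rewrite frac_wS -mulNr mulr_gt0 // divr_gt0 //.
by rewrite subr_gt0 (lt_le_trans d1) // ler1n.
Qed.

(** The partial sums of the coefficients of [(1 - z)^d] are the coefficients of [(1 - z)^(d-1)],
    hence the closed form. For [0 < d < 1] the last term is negative, so the sums stay below 1. *)
Lemma sum_frac_w (R : realType) (d : R) (n : nat) :
  d != 0 ->
  \sum_(0 <= k < n) - frac_w d k.+1 = 1 + frac_w d n.+1 * n.+1%:R / d.
Proof.
move=> d0; elim: n => [|n IH].
  by rewrite big_nil frac_w1 mulr1 mulNr divff // subrr.
rewrite big_nat_recr //= IH [frac_w d n.+2]frac_wS.
rewrite -[n.+2%:R]natr1; set m : R := n.+1%:R.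
have m0 : 0 < m by rewrite ltr0n.
by field; rewrite d0 gt_eqF //; lra.
Qed.

Lemma frac_w_ratio_cvg (R : realType) (d : R) :
  0 < d < 1 ->
  (fun k => frac_w d k.+2 / frac_w d k.+1) @ \oo --> (1 : R).
Proof.
move=> dd.
have H : (fun k => 1 - (1 + d) * harmonic k.+1) @ \oo --> (1 : R).
  rewrite -[X in _ --> X]subr0 -(mulr0 (1 + d)).
  apply: cvgB; first exact: cvg_cst.
  apply: cvgM; first exact: cvg_cst.
  by have := @cvg_harmonic R; rewrite -cvg_shiftS.
apply: (@cvgn_eq_from R _ _ _ 0) H => k _ /=.
rewrite [frac_w d k.+2]frac_wS mulrAC divff; last first.
  by have := frac_w_neg k dd; rewrite oppr_gt0 => /ltr0_neq0.
rewrite mul1r -[k.+2%:R]natr1; set m : R := k.+1%:R.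
have m0 : 0 < m by rewrite ltr0n.
by field; rewrite gt_eqF //; lra.
Qed.

(** The factor [(k+1)^2] outweighs the decay: for [d <= 1/2] the product is nondecreasing. Then
    [k + 1 <= 2 (j + 1)] costs a factor [2^2 = 4]. *)
Lemma frac_w_doubling (R : realType) (d : R) (j k : nat) :
  0 < d <= 1 / 2 -> (j <= k <= j.*2.+1)%N ->
  - frac_w d j.+1 <= 4 * - frac_w d k.+1.
Proof.
move=> /andP[d0 d12] /andP[jk kj].
have dd : 0 < d < 1 by rewrite d0 /=; lra.
have mono : {homo (fun k => - frac_w d k.+1 * k.+1%:R ^+ 2) : m n / (m <= n)%N >-> m <= n}.
  apply/nondecreasing_seqP => n.
  have v0 := frac_w_neg n dd.
  rewrite [frac_w d n.+2]frac_wS -[n.+2%:R]natr1.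
  have : (1 : R) <= n.+1%:R by rewrite ler1n.
  move: v0; set v := frac_w d n.+1; set m : R := n.+1%:R => v0 m1.
  have -> : - (v * ((m - d) / (m + 1))) * (m + 1) ^+ 2 = - v * ((m - d) * (m + 1)).
    by field; rewrite gt_eqF //; lra.
  by rewrite ler_pM2l //; nra.
have j0 : (0 : R) < j.+1%:R ^+ 2 by rewrite exprn_gt0.
rewrite -(ler_pM2r j0); apply: le_trans (mono _ _ jk) _.
rewrite [leRHS]mulrAC [leRHS]mulrC ler_pM2l ?frac_w_neg //.
rewrite -!natrX -natrM ler_nat; nia.
Qed.

(* Bernoulli's inequality makes |w_(k+1)| (k+1)^(d+1) decreasing and
   |w_(k+1)| (k+1) k^d increasing, hence the limit is positive. *)
Lemma frac_w_cvg (R : realType) (d : R) :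
  0 < d < 1 ->
  exists2 l : R, 0 < l &
    (fun k => - frac_w d k.+1 * k.+1%:R `^ (d + 1)) @ \oo --> l.
Proof.
move=> dd; have /andP[d0 d1] := dd.
have v0 k := frac_w_neg k dd.
pose u k : R := - frac_w d k.+1 * k.+1%:R `^ (d + 1).
have powS (m : nat) : (m.+1%:R : R) `^ (d + 1) = m.+1%:R `^ d * m.+1%:R.
  by rewrite powRD ?powRr1 // pnatr_eq0 implybT.
have udec k : u k.+1 <= u k.
  rewrite /u !powS frac_wS.
  have m1 : (1 : R) <= k.+1%:R by rewrite ler1n.
  have -> : (k.+2%:R : R) `^ d = k.+1%:R `^ d * (1 + k.+1%:R^-1) `^ d.
    rewrite -powRM ?addr_ge0 ?invr_ge0 //; congr (_ `^ _).
    by rewrite mulrDr mulr1 mulfV ?pnatr_eq0 // natr1.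
  have B : (1 + k.+1%:R^-1 : R) `^ d <= 1 + d / k.+1%:R.
    have -> : d / k.+1%:R = d * (1 + k.+1%:R^-1 - 1) by ring.
    by apply: powR_Bernoulli dd; rewrite addr_ge0 ?invr_ge0.
  move: (v0 k) B; set v := frac_w d k.+1 => vk.
  rewrite -[k.+2%:R]natr1; move: m1.
  set p := (1 + _) `^ d; set m : R := k.+1%:R => m1 B.
  have pm : 0 < m `^ d by rewrite powR_gt0; lra.
  have -> : - (v * ((m - d) / (m + 1))) * (m `^ d * p * (m + 1)) =
            - v * m `^ d * ((m - d) * p).
    by field; rewrite gt_eqF //; lra.
  rewrite [leRHS]mulrA ler_pM2l ?mulr_gt0 //.
  apply: (@le_trans _ _ ((m - d) * (1 + d / m))).
    by rewrite ler_pM2l //; lra.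
  have -> : (m - d) * (1 + d / m) = m - d ^+ 2 / m by field; rewrite gt_eqF //; lra.
  by rewrite gerBl divr_ge0 ?exprn_ge0 //; lra.
(* The bound is the value at [k = 0] of the increasing sequence [|w_(k+2)| (k+2) (k+1)^d], which
   lies below [u k.+1]. *)
have ulow k : 2 * - frac_w d 2 <= u k.+1.
  have : 2 * - frac_w d 2 <= - frac_w d k.+2 * k.+2%:R * k.+1%:R `^ d.
    elim: k => [|k]; first by rewrite powR1 mulr1 mulrC.
    move/le_trans; apply.
    rewrite [frac_w d k.+3]frac_wS.
    have m1 : (1 : R) <= k.+2%:R by rewrite ler1n.
    have B := @powR_Bernoulli R (k.+1%:R / k.+2%:R) d (divr_ge0 (ler0n _ _) (ler0n _ _)) dd.
    have -> : (k.+1%:R : R) `^ d = k.+2%:R `^ d * (k.+1%:R / k.+2%:R) `^ d.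
      by rewrite -powRM ?divr_ge0 // mulrCA mulfV ?mulr1 // pnatr_eq0.
    have {}B : k.+2%:R * (k.+1%:R / k.+2%:R : R) `^ d <= k.+2%:R - d.
      have m0 : (0 : R) < k.+2%:R by rewrite ltr0n.
      have := ler_wpM2l (ltW m0) B; congr (_ <= _).
      have m1' : (0 : R) < k.+1%:R by rewrite ltr0n.
      by rewrite -[k.+2%:R]natr1; field; rewrite gt_eqF //; lra.
    move: (v0 k.+1) B; set v := frac_w d k.+2; set p := (_ / _) `^ d => vk.
    rewrite -[k.+3%:R]natr1; move: m1; set m : R := k.+2%:R => m1 B.
    have pm : 0 < m `^ d by rewrite powR_gt0; lra.
    have -> : - (v * ((m - d) / (m + 1))) * (m + 1) * m `^ d =
              - v * m `^ d * (m - d) by field; rewrite gt_eqF //; lra.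
    have -> : - v * m * (m `^ d * p) = - v * m `^ d * (m * p) by ring.
    by rewrite ler_pM2l // mulr_gt0.
  move/le_trans; apply.
  rewrite /u powS -mulrA ler_pM2l // mulrC ler_wpM2r //.
  by rewrite ge0_ler_powR ?nnegrE ?ler_nat // ltW.
have ucvg : u @ \oo --> limn u.
  apply: nonincreasing_is_cvgn; first exact/nonincreasing_seqP.
  exists 0 => _ [k _ <-].
  by rewrite /u mulr_ge0 ?powR_ge0 // ltW.
exists (limn u) => //.
apply: (@lt_le_trans _ _ (2 * - frac_w d 2)); first by rewrite mulr_gt0.
apply: limr_ge; first by apply: cvgP ucvg.
by exists 1%N => // -[|k] //= _; exact: ulow.
Qed.

(** * Linear recurrences *)

(* T p k is p(E) u_k for the sequence u_k = (U M^k V)_ij and the shift E. *)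
Definition poly_shift (R : realType) (p n r : nat) (U : 'M[R]_(r, n.+1))
    (M : 'M[R]_n.+1) (V : 'M[R]_(n.+1, p)) (i : 'I_r) (j : 'I_p)
    (P : {poly R}) (k : nat) : R :=
  (U *m (horner_mx M P *m (M ^+ k *m V))) i j.

Section PolyShift.
Context (R : realType) (p n r : nat) (U : 'M[R]_(r, n.+1)) (M : 'M[R]_n.+1)
  (V : 'M[R]_(n.+1, p)) (i : 'I_r) (j : 'I_p).
Local Notation T := (poly_shift U M V i j).

Lemma poly_shift_mulX (P : {poly R}) (k : nat) : T (P * 'X) k = T P k.+1.
Proof.
by rewrite /poly_shift rmorphM /= horner_mx_X exprS -!mulmxA.
Qed.

Lemma poly_shiftD (P Q : {poly R}) (k : nat) : T (P + Q) k = T P k + T Q k.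
Proof. by rewrite /poly_shift rmorphD /= mulmxDl mulmxDr mxE. Qed.

Lemma poly_shiftC (P : {poly R}) (a : R) (k : nat) :
  T (P * a%:P) k = a * T P k.
Proof.
by rewrite /poly_shift rmorphM /= horner_mx_C -[_ * _]/(_ *m _) mul_mx_scalar
  -!(scalemxAl, scalemxAr) mxE.
Qed.

(** Relative to [g] the shift acts in the limit as the identity, so a polynomial in the shift acts
    as its value at 1. Only [g k.+1] is required to be nonzero, because the power used later is 0 at
    [k = 0]. *)
Lemma poly_shift_cvg (g : nat -> R) (c : R) (P : {poly R}) :
  (forall k, g k.+1 != 0) -> (fun k => g k.+1 / g k) @ \oo --> (1 : R) ->
  (fun k => T 1 k / g k) @ \oo --> c ->
  (fun k => T P k / g k) @ \oo --> c * P.[1].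
Proof.
move=> g0 g1 Tc; elim/poly_ind: P => [|P a IH].
  rewrite horner0 mulr0.
  apply: (@cvgn_eq_from R (fun=> 0) _ _ 0) (cvg_cst (0 : R)) => k _.
  by rewrite /poly_shift rmorph0 mul0mx mulmx0 mxE mul0r.
have H1 : (fun k => T P k.+1 / g k.+1 * (g k.+1 / g k)) @ \oo --> c * P.[1] * 1.
  by apply: cvgM => //; have := IH; rewrite -cvg_shiftS.
have H2 : (fun k => a * (T 1 k / g k)) @ \oo --> a * c.
  by apply: cvgM => //; exact: cvg_cst.
have -> : c * (P * 'X + a%:P).[1] = c * P.[1] * 1 + a * c.
  by rewrite !hornerE; ring.
apply: (@cvgn_eq_from R _ _ _ 0) (cvgD H1 H2) => k _.
rewrite !fctE poly_shiftD poly_shift_mulX -[a%:P]mul1r poly_shiftC.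
by rewrite mulrA divfK // mulrDl mulrA.
Qed.

(* If the annihilator P had a least degree, dividing it by X - 1 would give a
   sequence that is constant and tends to 0. *)
Lemma no_annihilator (g : nat -> R) (c : R) (P : {poly R}) :
  (forall k, g k.+1 != 0) -> (fun k => g k.+1 / g k) @ \oo --> (1 : R) ->
  g @ \oo --> (0 : R) -> c != 0 ->
  (fun k => T 1 k / g k) @ \oo --> c ->
  P != 0 -> ~ (forall k, T P k = 0).
Proof.
move=> g0 g1 g_0 c0 Tc; have [m] := ubnP (size P).
elim: m P => // m IH P sP P0 TP.
have : root P 1.
  have : (fun k => T P k / g k) @ \oo --> (0 : R).
    apply: (@cvgn_eq_from R (fun=> 0) _ _ 0) (cvg_cst (0 : R)) => k _.
    by rewrite TP mul0r.
  move/(cvg_unique _ (poly_shift_cvg (P := P) g0 g1 Tc)) => /(_ (@Rhausdorff R)) /eqP.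
  by rewrite mulf_eq0 (negPf c0).
move=> /factor_theorem[Q PQ].
have Q0 : Q != 0 by apply: contraNneq P0 => Q0; rewrite PQ Q0 mul0r.
apply: (IH Q) => //.
  by rewrite PQ size_Mmonic ?monicXsubC // size_XsubC addn2 /= in sP.
have TS k : T Q k.+1 = T Q k.
  have := TP k; rewrite PQ -polyCN mulrDr poly_shiftD poly_shift_mulX poly_shiftC.
  by move=> /eqP; rewrite mulN1r subr_eq0 => /eqP.
have TQ0 k : T Q k = T Q 0%N by elim: k => // k <-; exact: TS.
have : (fun k => T Q k / g k * g k) @ \oo --> c * Q.[1] * 0.
  by apply: cvgM => //; exact: poly_shift_cvg.
rewrite mulr0 => H k; rewrite TQ0.
have : (fun=> T Q 0%N) @ \oo --> (0 : R).
  (* Index 0 is skipped, since [g] may vanish there. *)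
  apply: (@cvgn_eq_from R _ _ _ 1) H => -[//|l] _.
  by rewrite divfK // TQ0.
by move/(cvg_unique _ (cvg_cst _)) => /(_ (@Rhausdorff R)).
Qed.
End PolyShift.

(** By Cayley-Hamilton the characteristic polynomial of [M], nonzero because monic, is an
    annihilator. *)
Lemma no_power_decay (R : realType) (p n r : nat) (U : 'M[R]_(r, n.+1))
    (M : 'M[R]_n.+1) (V : 'M[R]_(n.+1, p)) (i : 'I_r) (j : 'I_p)
    (e : R) :
  0 < e -> ~ asym_prop_pow (fun k => (U *m (M ^+ k *m V)) i j) e.
Proof.
move=> e0 [c [c0 uc]].
pose g k : R := k%:R `^ (- e - 1).
have H : (fun k => poly_shift U M V i j 1 k / g k) @ \oo --> c.
  apply: (@cvgn_eq_from R _ _ _ 0) uc => k _.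
  by rewrite /poly_shift rmorph1 mul1mx.
apply: (no_annihilator _ _ _ c0 H (monic_neq0 (char_poly_monic M))).
- by move=> k; rewrite /g gt_eqF // powR_gt0 // ltr0n.
(* After a shift the ratio of powers is [(1 - 1/(k+2))^(e+1)], handled by continuity of [ln] and
   [expR]. *)
- have x1 : (fun k => 1 - harmonic k.+1) @ \oo --> (1 : R).
    rewrite -[X in _ --> X]subr0; apply: cvgB; first exact: cvg_cst.
    by have := @cvg_harmonic R; rewrite -cvg_shiftS.
  have lnx : (fun k => (e + 1) * ln (1 - harmonic k.+1)) @ \oo --> (0 : R).
    rewrite -(mulr0 (e + 1)) -(@ln1 R); apply: cvgM; first exact: cvg_cst.
    exact: (@continuous_cvg _ _ _ _ _ _ (@ln R) (1 : R) (continuous_ln ltr01) x1).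
  have ex : (fun k => expR ((e + 1) * ln (1 - harmonic k.+1))) @ \oo --> (1 : R).
    have := @continuous_cvg _ _ _ _ _ _ (@expR R) 0 (@continuous_expR R 0) lnx.
    rewrite expR0; exact.
  rewrite -cvg_shiftS; apply: (@cvgn_eq_from R _ _ _ 0) ex => k _ /=.
  have k1 : (0 : R) < k.+1%:R by rewrite ltr0n.
  have -> : 1 - (k.+2%:R : R)^-1 = k.+1%:R / k.+2%:R.
    by rewrite -[k.+2%:R]natr1; field; rewrite gt_eqF //; lra.
  rewrite /g -opprD !powRN invrK /powR !pnatr_eq0 /= -expRN -expRD.
  rewrite ln_div ?posrE //; congr expR; ring.
- rewrite -cvg_shiftS.
  apply: (@squeeze_cvgr _ _ _ _ (fun=> 0) harmonic) => //; last 2 first.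
  + exact: cvg_cst.
  + exact: cvg_harmonic.
  exists 0%N => // k _ /=; rewrite powR_ge0 /= -powR_inv1 //.
  by rewrite ler_powR ?ler1n //; lra.
- by move=> k; rewrite /poly_shift Cayley_Hamilton mul0mx mulmx0 mxE.
Qed.

(** * Network coefficients *)

Lemma lstm_C_expr (R : realType) (p q : nat) (Wch : 'M[R]_q.+1)
    (Wcx : 'M[R]_(q.+1, p)) (di df dout : 'rV[R]_q.+1) (k : nat) :
  lstm_C Wch Wcx di df dout k =
  (diag_mx di *m Wch *m diag_mx dout + diag_mx df) ^+ k *m (diag_mx di *m Wcx).
Proof.
elim: k => [|k IH] /=; first by rewrite expr0 mul1mx.
by rewrite IH mulmxA exprS.
Qed.

Lemma lstm_no_long_memory (R : realType) (p q r : nat) (Wzh : 'M[R]_(r, q))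
    (Wch : 'M[R]_q) (Wcx : 'M[R]_(q, p)) (di df dout : 'rV[R]_q) :
  ~ long_memory (lstm_coeffs Wzh Wch Wcx di df dout).
Proof.
(* Matrix powers require a size [q.+1]. For an empty state all coefficients vanish, which
   contradicts [c != 0]. *)
case: q Wzh Wch Wcx di df dout => [|q] Wzh Wch Wcx di df dout
  [i [j [e [/andP[e0 _] A]]]].
- case: A => c [/eqP c0 A]; apply: c0.
  set u := fun k => _ in A.
  have u0 : u @ \oo --> (0 : R).
    apply: (@cvgn_eq_from R (fun=> 0) _ _ 0) (cvg_cst (0 : R)) => k _.
    by rewrite /u /lstm_coeffs -mulmxA mxE big_ord0 mul0r.
  exact: (cvg_unique (@Rhausdorff R) A u0).
- apply: (no_power_decay e0 (U := Wzh *m diag_mx dout)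
    (M := diag_mx di *m Wch *m diag_mx dout + diag_mx df)
    (V := diag_mx di *m Wcx) (i := i) (j := j)).
  case: A => c [c0 A]; exists c; split=> //.
  apply: (@cvgn_eq_from R _ _ _ 0) A => k _.
  by rewrite /lstm_coeffs lstm_C_expr.
Qed.

Section MLSTMRecursion.
Context (R : realType) (p q : nat) (d : 'rV[R]_q) (Wch : 'M[R]_q)
  (Wcx : 'M[R]_(q, p)) (di dout : 'rV[R]_q).
Local Notation hist := (mlstm_hist d Wch Wcx di dout).
Local Notation C := (mlstm_C d Wch Wcx di dout).

Lemma size_mlstm_hist (k : nat) : size (hist k) = k.+1.
Proof. by elim: k => //= k IH; rewrite size_rcons IH. Qed.

(** Histories grow only at the end, so earlier entries are never altered. *)
Lemma nth_mlstm_hist (k j : nat) : (j <= k)%N -> nth 0 (hist k) j = C j.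
Proof.
elim: k => [|k IH]; first by rewrite leqn0 => /eqP ->.
rewrite leq_eqVlt => /predU1P[-> //|jk].
by rewrite /= nth_rcons size_mlstm_hist jk IH.
Qed.

Lemma mlstm_CS (k : nat) :
  C k.+1 = diag_mx di *m Wch *m diag_mx dout *m C k
    - \sum_(j < k.+1) diag_mx (\row_l frac_w (d 0 l) j.+1) *m C (k - j)%N.
Proof.
rewrite {1}/mlstm_C /= nth_rcons size_mlstm_hist ltnn eqxx.
rewrite nth_mlstm_hist //; congr (_ - _).
by apply: eq_bigr => j _; rewrite nth_mlstm_hist // leq_subr.
Qed.
End MLSTMRecursion.

Section ScalarMLSTM.
Context (R : realType) (d : R) (d_range : 0 < d <= 1 / 2).

(* Coefficients of 1 - (1 - z)^d - (d / 2) z, from z^1 on. *)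
Let b (k : nat) : R := - frac_w d k.+1 - (if k == 0%N then d / 2 else 0).

Let d0 : 0 < d. Proof. by case/andP: d_range. Qed.
Let d01 : 0 < d < 1. Proof. by case/andP: d_range => *; apply/andP; split; lra. Qed.

(** Only [b 0] is lowered, from [d] to [d / 2]. *)
Let b_gt0 k : 0 < b k.
Proof.
rewrite /b; case: k => [|k] /=; last by rewrite subr0 frac_w_neg.
by rewrite frac_w1; have := d0; lra.
Qed.

(** Lowering [b 0] affects only the left side, except for [j = k = 0], where positivity suffices. *)
Let b_doubling j k : (j <= k <= j.*2.+1)%N -> b j <= 4 * b k.
Proof.
move=> jk; have := b_gt0 k; have := frac_w_doubling d_range jk; have := d0.
case: j jk => [|j] jk; last first.
  case: k jk => [//|k jk] _; rewrite /b /= !subr0; exact.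
case: k jk => [|k] jk; rewrite /b /= ?subr0; lra.
Qed.

Let b_ratio : (fun k => b k.+1 / b k) @ \oo --> (1 : R).
Proof.
apply: (@cvgn_eq_from R _ _ _ 1) (frac_w_ratio_cvg d01) => -[//|k] _.
by rewrite /b /= !subr0 invrN mulrNN.
Qed.

(** The unmodified weights have partial sums at most 1; the [d / 2] removed at index 0 makes the
    renewal sequence defective. *)
Let b_sum n : \sum_(0 <= k < n) b k <= 1 - d / 2.
Proof.
have := d01; case: n => [|n] dd; first by rewrite big_nil; lra.
rewrite sumrB sum_frac_w ?gt_eqF // big_nat_recl //= big1 // addr0.
rewrite lerD2r gerDl -mulrA pmulr_lle0 ?(divr_gt0 _ d0) //.
by have := frac_w_neg n.+1 dd; rewrite oppr_gt0 => /ltW.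
Qed.

(** Absorbing [- (d / 2) * c k] into the term [j = 0] of the convolution gives a renewal recursion
    for [b]. The limits of [c k.+1 / b k] and of [b k] times [(k+1)^(d+1)] then multiply. *)
Lemma scalar_mlstm_cvg (c : nat -> R) :
  c 0%N = 1 ->
  (forall k, c k.+1 =
     - (d / 2) * c k - \sum_(0 <= j < k.+1) frac_w d j.+1 * c (k - j)%N) ->
  asym_prop_pow c d.
Proof.
move=> c0 rec.
have rec_b k : c k.+1 = \sum_(0 <= j < k.+1) b j * c (k - j)%N.
  rewrite rec big_nat_recl // [in RHS]big_nat_recl // subn0 /b /=.
  under [in RHS]eq_bigr do rewrite subr0 mulNr.
  by rewrite sumrN; ring.
have b_cvg := nonneg_series_is_cvg (fun k => ltW (b_gt0 k)) b_sum.
have rho1 : limn (series b) < 1.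
  apply: (@le_lt_trans _ _ (1 - d / 2)); last by have := d0; lra.
  by apply: (cvgn_bounded_le (K := 0%N)) b_cvg => k _; rewrite seriesEnat; exact: b_sum.
have [l l0 wl] := frac_w_cvg d01.
have x_cvg := renewal_ratio b_gt0 b_doubling b_ratio b_cvg rho1 c0 rec_b.
set L := _ ^+ 2 in x_cvg.
exists (L * l); split.
  by rewrite mulf_neq0 ?(gt_eqF l0) // expf_neq0 // invr_neq0 // subr_eq0 gt_eqF.
rewrite -cvg_shiftS.
(* From index 1 on, [b k] is exactly [- frac_w d k.+1]. *)
apply: (@cvgn_eq_from R _ _ _ 1) (cvgM x_cvg wl) => -[//|k] _ /=.
have := b_gt0 k.+1; rewrite /b /= subr0 -opprD powRN invrK => w0.
by rewrite mulrA divfK // gt_eqF.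
Qed.
End ScalarMLSTM.

Theorem theorem4 (R : realType) :
  (* constant-gates-LSTM: never long memory *)
  (forall (p q r : nat) (Wzh : 'M[R]_(r, q)) (Wch : 'M[R]_q)
          (Wcx : 'M[R]_(q, p)) (di df dout : 'rV[R]_q),
      ~ long_memory (lstm_coeffs Wzh Wch Wcx di df dout)) /\
  (* constant-gates-MLSTM: can have long memory *)
  (forall (p q r : nat), exists (d : 'rV[R]_q.+1) (Wzh : 'M[R]_(r.+1, q.+1))
          (Wch : 'M[R]_q.+1) (Wcx : 'M[R]_(q.+1, p.+1)) (di dout : 'rV[R]_q.+1),
      (forall l, 0 < d 0 l < 1/2) /\
      long_memory (mlstm_coeffs d Wzh Wch Wcx di dout)).
Proof.
split; first exact: lstm_no_long_memory.
(* Any [d] strictly between 0 and 1/2 would serve. The two [delta_mx 0 0] feed the first input into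
   the first state coordinate and read it back, which reduces the entry [(0, 0)] to the scalar
   recursion. *)
move=> p q r; pose d : R := 1 / 4.
exists (const_mx d), (delta_mx 0 0), (- (d / 2))%:M, (delta_mx 0 0),
  (const_mx 1), (const_mx 1).
split; first by move=> l; rewrite mxE /d; apply/andP; split; lra.
exists 0, 0, d; split; first by rewrite /d; apply/andP; split; lra.
set C := mlstm_C (const_mx d) (- (d / 2))%:M (delta_mx 0 0 : 'M[R]_(q.+1, p.+1))
  (const_mx 1) (const_mx 1).
have entry k : mlstm_coeffs (const_mx d) (delta_mx 0 0 : 'M[R]_(r.+1, q.+1))
    (- (d / 2))%:M (delta_mx 0 0 : 'M[R]_(q.+1, p.+1)) (const_mx 1) (const_mx 1)
    k 0 0 = C k 0 0.
  rewrite /mlstm_coeffs -/C diag_const_mx mulmx1 mxE big_ord_recl big1.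
    by rewrite mxE !eqxx mul1r addr0.
  by move=> j _; rewrite mxE andbF mul0r.
have -> : (fun k => mlstm_coeffs (const_mx d) (delta_mx 0 0 : 'M[R]_(r.+1, q.+1))
    (- (d / 2))%:M (delta_mx 0 0 : 'M[R]_(q.+1, p.+1)) (const_mx 1) (const_mx 1)
    k 0 0) = (fun k => C k 0 0) by apply/funext => k; exact: entry.
apply: scalar_mlstm_cvg.
- by rewrite /d; apply/andP; split; lra.
- by rewrite /C /mlstm_C /= diag_const_mx mul1mx mxE.
move=> k; rewrite /C mlstm_CS -/C diag_const_mx mul1mx mulmx1 mul_scalar_mx.
rewrite !mxE summxE big_mkord; congr (_ - _).
by apply: eq_bigr => j _; rewrite mul_diag_mx !mxE.
Qed.
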